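(* Let $W\in\mathbb{C}[z_1,\dots,z_n]$ be a non-degenerate weighted homogeneous polynomial of weight $(w_1,\dots,w_n;h)$ with maximal diagonal symmetry group $G_W$. For every $g\in G_W$ and $l>0$ for which the space $\Sigma_{g,l}$ of $g$-twisted Reeb orbits of period $l$ in the link of $W$ is non-empty, $$\star_{g,l}\ \ge\ -\frac{2l\big(\sum_{k=1}^nw_k-h\big)}{h}.$$
   Context: $W(\lambda^{w_1}z_1,\dots,\lambda^{w_n}z_n)=\lambda^hW(z)$, $\gcd(w_1,\dots,w_n,h)=1$; non-degenerate means isolated singularity at $0$ and no monomial $x_ix_j$, $i\neq j$. $G_W$ is the finite group of diagonal symmetries of $W$. For $g\in G_W$ write $g=(e^{2\pi i\theta_{g,1}},\dots,e^{2\pi i\theta_{g,n}})$, $\theta_{g,i}\in[0,1)$; $J=(e^{2\pi iw_k/h})_k$, $\theta_{J,k}=w_k/h$. The Reeb flow on the link $L_W=W^{-1}(0)\cap S^{2n-1}_\delta$ is $\mathcal{R}_t(z)=(e^{2\pi i\theta_{J,k}t}z_k)_k$. $(\mathbb{C}^n)^{g,l}=\{z: z_i\ne0\Rightarrow\theta_{g,i}+l\theta_{J,i}\in\mathbb{Z}\}$ is the fixed locus of $g\circ\mathcal{R}_l$, and $\Sigma_{g,l}=(\mathbb{C}^n)^{g,l}\cap L_W$ parametrizes flow lines $\gamma:[0,l]\to L_W$ with $g\gamma(l)=\gamma(0)$. $\mu_{RS}(\Sigma_{g,l})$ is the fractional Robbin–Salamon index of the linearized Reeb flow on $TM_W=\ker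 dW$ (with $M_W$ the Milnor fiber) along such an orbit: for a complex frame $(f_i)$ of $\ker dW$ along $\gamma$ with $g\cdot f_i(l)=f_i(0)$, it is the Robbin–Salamon index of the linearized flow in the frame plus $2$ times the total change of $\frac1{2\pi}\arg\Omega_{M_W}(f_1,\dots,f_{n-1})$ over $[0,l]$, where $\Omega_{M_W}=\mathrm{Res}_W\,dz_1\wedge\dots\wedge dz_n$. Explicitly, with $I=\{i:\partial_iW|_{(\mathbb{C}^n)^{g,l}}\equiv0\}$, $I^c$ its complement, and $Q(s)=2s$ for $s\in\mathbb{Z}$, $Q(s)=2\lfloor s\rfloor+1$ otherwise, $$\mu_{RS}(\Sigma_{g,l})=2\Big(-\sum_{i\in I}\theta_{g,i}+\sum_{j\in I^c}(l\theta_{J,j}-l)\Big)+\sum_{i\in I}Q(l\theta_{J,i}+\theta_{g,i})+(|I^c|-1)Q(l).$$ The degree shifting number is $\star_{g,l}=(n-1)-\mu_{RS}(\Sigma_{g,l})-\frac12(\dim_{\mathbb{R}}\Sigma_{g,l}+1)\in\mathbb{Q}$. *)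

(* Defs.v *)
From HB Require Import structures.
From mathcomp Require Import all_boot all_order all_algebra.
From mathcomp Require Import all_classical all_reals all_analysis.
From mathcomp Require Import complex.
(* Not imported: the notations of mpoly clash with those of analysis. *)
From mathcomp Require mpoly.

Set Implicit Arguments.
Unset Strict Implicit.
Unset Printing Implicit Defensive.

Import Order.TTheory GRing.Theory Num.Theory.
Import numFieldNormedType.Exports.

Local Open Scope classical_set_scope.
Local Open Scope ring_scope.

(** ** Real dimension of a subset of R^N *)

Section Submanifold.
Variable R : realType.

(* phi is a C^1 immersion of the open set V of R^d which is a homeomorphism
   onto S `&` U, with inverse psi. *)
Definition C1_parametrization (N d : nat) (S U : set 'rV[R]_N)
    (V : set 'rV[R]_d) (phi : 'rV[R]_d -> 'rV[R]_N)
    (psi : 'rV[R]_N -> 'rV[R]_d) : Prop :=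
  [/\ open V,
      phi @` V = S `&` U,
      forall x, V x ->
        [/\ differentiable phi x,
            forall v, {for x, continuous (fun y => 'd phi y v)} &
            injective ('d phi x)],
      forall x, V x -> psi (phi x) = x &
      {within S `&` U, continuous psi}].

Definition submanifold (N d : nat) (S : set 'rV[R]_N) : Prop :=
  forall p, S p ->
    exists U : set 'rV[R]_N, [/\ open U, U p &
      exists (V : set 'rV[R]_d) phi psi, C1_parametrization S U V phi psi].

(* The dimension of a nonempty submanifold; 0 by convention if S is not a
   submanifold. *)
Definition dimR (N : nat) (S : set 'rV[R]_N) : nat :=
  xget 0%N [set d | submanifold d S].

End Submanifold.

Section LandauGinzburg.
Variables (R : realType) (n : nat).
Local Notation C := R[i].
Local Notation polyW := (mpoly.mpoly n C).

Definition cis2pi (t : R) : C := (cos (2 * pi * t) +i* sin (2 * pi * t))%C.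

(* C^n as R^(2n), via real and imaginary parts *)
Definition realify (z : 'rV[C]_n) : 'rV[R]_(n + n) :=
  row_mx (map_mx (@complex.Re R) z) (map_mx (@complex.Im R) z).

Definition sqnorm (z : 'rV[C]_n) : R :=
  \sum_(i < n) (complex.Re (z 0 i) ^+ 2 + complex.Im (z 0 i) ^+ 2).

Definition peval (W : polyW) (z : 'rV[C]_n) : C := mpoly.meval (z 0) W.

Definition partial (i : 'I_n) (W : polyW) : polyW := mpoly.mderiv i W.

Definition weighted_homogeneous (W : polyW) (w : 'I_n -> nat) (h : nat) : Prop :=
  [/\ forall i, (0 < w i)%N,
      (0 < h)%N,
      gcdn (\big[gcdn/0%N]_(i < n) w i) h = 1%N &
      forall (lambda : C) (z : 'rV[C]_n),
        peval W (\row_i (lambda ^+ w i * z 0 i)) = lambda ^+ h * peval W z].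

Definition critical (W : polyW) (z : 'rV[C]_n) : Prop :=
  forall i, peval (partial i W) z = 0.

Definition isolated_singularity0 (W : polyW) : Prop :=
  critical W 0 /\
  exists2 e : R, 0 < e & forall z, sqnorm z < e -> critical W z -> z = 0.

Definition nondegenerate_poly (W : polyW) : Prop :=
  isolated_singularity0 W /\
  forall i j : 'I_n, i != j ->
    mpoly.mcoeff (mpoly.mnm_add (mpoly.mnm1 i) (mpoly.mnm1 j)) W = 0.

(* G_W; the vector g stands for the diagonal matrix with entries g 0 i. *)
Definition diagonal_symmetries (W : polyW) : set 'rV[C]_n :=
  [set g : 'rV[C]_n | (forall i, g 0 i != 0) /\
           forall z : 'rV[C]_n,
             peval W (\row_i (g 0 i * z 0 i)) = peval W z].

(* theta lists the angles theta_{g,i} of g. *)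
Definition angles_of (g : 'rV[C]_n) (theta : 'I_n -> R) : Prop :=
  forall i, 0 <= theta i < 1 /\ g 0 i = cis2pi (theta i).

Definition link (W : polyW) (delta : R) : set 'rV[C]_n :=
  [set z : 'rV[C]_n | peval W z = 0 /\ sqnorm z = delta ^+ 2].

Variables (W : polyW) (w : 'I_n -> nat) (h : nat) (delta : R).

(* g enters the definitions below through its angles theta. *)
Variables (theta : 'I_n -> R) (l : R).

Definition thetaJ (i : 'I_n) : R := (w i)%:R / h%:R.

Definition fixed_locus : set 'rV[C]_n :=
  [set z : 'rV[C]_n | forall i, z 0 i != 0 -> theta i + l * thetaJ i \is a Num.int].

Definition Sigma : set 'rV[C]_n := fixed_locus `&` link W delta.

Definition Iset : pred 'I_n :=
  fun i => `[< forall z, fixed_locus z -> peval (partial i W) z = 0 >].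

Definition Iset_compl : pred 'I_n := fun i => ~~ Iset i.

(* Robbin-Salamon index of the path t |-> exp(2 pi i s t) in U(1), 0 <= t <= 1 *)
Definition Q (s : R) : R :=
  if s \is a Num.int then 2 * s else 2 * (Num.floor s)%:~R + 1.

(* The frame of ker dW along a g-twisted orbit of period l is the trace on
   ker dW of the frame of C^n given by exp(- 2 pi i theta_{g,i} t / l) e_i for
   i in I, and by exp(2 pi i (theta_{J,j} - 1) t) e_j for j outside I.
   [arg_change] is the total change along it of arg(Omega)/(2 pi), and
   [RS_in_frame] is the index of the linearized flow in it: in this frame the
   flow is diagonal on the I-part, with angles (theta_{J,i} + theta_{g,i}/l) t,
   and is exp(2 pi i t) on a constant hyperplane of the other part. *)
Definition arg_change : R :=
  - (\sum_(i | Iset i) theta i) + \sum_(j | Iset_compl j) (l * thetaJ j - l).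

Definition RS_in_frame : R :=
  \sum_(i | Iset i) Q (l * thetaJ i + theta i)
  + (#|Iset_compl|%:R - 1) * Q l.

Definition mu_RS : R := 2 * arg_change + RS_in_frame.

Definition star : R :=
  (n%:R - 1) - mu_RS - ((dimR (realify @` Sigma))%:R + 1) / 2.

End LandauGinzburg.

(* Main.v *)
(* Write s_i = l theta_{J,i} + theta_{g,i}, F = {i : s_i integer} and N = |F|.
   Expanding the definitions, the claimed bound reads
     0 <= n - 1 - (dim Sigma + 1)/2 + sum_{i in I} (2 s_i - Q s_i)
          + (|I^c| - 1) (2 l - Q l),
   where 2 s - Q s vanishes for integral s and is >= -1 otherwise.
   The complement of I is nonempty because a point of Sigma is not critical, and
   for i outside I equivariance of dW gives: s_i is integral iff l is. If l is
   integral, W restricts to a nonconstant function on the fixed locus and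
   dim Sigma <= 2N - 3; otherwise F lies in I and dim Sigma <= 2N - 1 is enough.
   These two bounds are linear algebra in the image of the differential of a
   parametrization: it is annihilated by dW and by the differential of the norm,
   whereas the Euler field lies in ker dW and is transverse to the sphere. *)
Require Import Defs.
From HB Require Import structures.
From mathcomp Require Import all_boot all_order all_algebra.
From mathcomp Require Import all_classical all_reals all_analysis.
From mathcomp Require Import complex ring lra.
From mathcomp Require mpoly.
Import Order.TTheory GRing.Theory Num.Theory.
Import numFieldNormedType.Exports.
(* Without its notations, which clash with those of analysis. *)
Import (canonicals, coercions) mpoly.
Local Open Scope classical_set_scope.
Local Open Scope ring_scope.
Set Implicit Arguments.
Unset Strict Implicit.
Unset Printing Implicit Defensive.

(** * Polynomials and their derivatives along real curves *)

Lemma mpoly_algebra_ind n (K : comNzRingType) (P : mpoly.mpoly n K -> Prop) :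
  (forall a, P (mpoly.mpolyC n a)) ->
  (forall i, P (mpoly.mpolyX K (mpoly.mnm1 i))) ->
  (forall p q, P p -> P q -> P (p + q)) ->
  (forall p q, P p -> P q -> P (p * q)) ->
  forall p, P p.
Proof.
move=> PC PX PD PM; have P1 : P 1 by exact: PC.
have PXn p k : P p -> P (p ^+ k).
  by move=> hp; elim: k => [|k IH]; rewrite ?expr0 // exprS; exact: PM.
elim/mpoly.mpolyind => [|a m p _ _ hp]; first by rewrite -mpoly.mpolyC0; exact: PC.
apply: PD => //; rewrite -mpoly.mul_mpolyC; apply: (PM); first exact: PC.
rewrite mpoly.mpolyXE_id.
by apply: (big_ind P) => [||i _]; [exact: P1 | exact: PM | exact: PXn].
Qed.

Section ComplexDerivative.
Variable R : realType.
Local Notation C := R[i].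
Local Notation Re := (@complex.Re R).
Local Notation Im := (@complex.Im R).

Lemma ReD (x y : C) : Re (x + y) = Re x + Re y. Proof. by case: x; case: y. Qed.
Lemma ImD (x y : C) : Im (x + y) = Im x + Im y. Proof. by case: x; case: y. Qed.

Lemma ReM (K : fieldType) (x y : K[i]) :
  complex.Re (x * y) = complex.Re x * complex.Re y - complex.Im x * complex.Im y.
Proof. by case: x; case: y. Qed.

Lemma ImM (K : fieldType) (x y : K[i]) :
  complex.Im (x * y) = complex.Re x * complex.Im y + complex.Im x * complex.Re y.
Proof. by case: x; case: y. Qed.

Lemma eq_ReIm (x y : C) : Re x = Re y -> Im x = Im y -> x = y.
Proof. by case: x => a b; case: y => a' b' /= -> ->. Qed.

(* By real and imaginary parts: [R[i]] is not a normed module over [R]. *)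
Definition is_cderive (t : R) (f : R -> C) (df : C) :=
  is_derive t 1 (fun s => Re (f s)) (Re df) /\
  is_derive t 1 (fun s => Im (f s)) (Im df).

Lemma is_cderive_unique t f a b :
  is_cderive t f a -> is_cderive t f b -> a = b.
Proof.
move=> [ra ia] [rb ib]; apply: eq_ReIm.
- by rewrite -(@derive_val _ _ _ _ _ _ _ ra) -(@derive_val _ _ _ _ _ _ _ rb).
- by rewrite -(@derive_val _ _ _ _ _ _ _ ia) -(@derive_val _ _ _ _ _ _ _ ib).
Qed.

Lemma near_eq_is_cderive t f g df : (\near t, f t = g t) ->
  is_cderive t f df -> is_cderive t g df.
Proof.
move=> fg [rf jf]; split; [apply: near_eq_is_derive rf | apply: near_eq_is_derive jf];
  by apply: filterS fg => s ->.
Qed.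

Lemma is_cderive_cst t c : is_cderive t (fun=> c) 0.
Proof. by split; exact: is_derive_cst. Qed.

Lemma is_cderiveD t f g df dg : is_cderive t f df -> is_cderive t g dg ->
  is_cderive t (fun s => f s + g s) (df + dg).
Proof.
move=> [rf jf] [rg jg]; split.
- rewrite ReD (_ : (fun s => _) = (fun s => Re (f s)) + (fun s => Re (g s))).
    exact: is_deriveD.
  by apply/funext => s /=; rewrite ReD.
- rewrite ImD (_ : (fun s => _) = (fun s => Im (f s)) + (fun s => Im (g s))).
    exact: is_deriveD.
  by apply/funext => s /=; rewrite ImD.
Qed.

Lemma is_cderiveM t f g df dg : is_cderive t f df -> is_cderive t g dg ->
  is_cderive t (fun s => f s * g s) (df * g t + dg * f t).
Proof.
move=> [rf jf] [rg jg]; split.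
- rewrite (_ : (fun s => _) = (fun s => Re (f s)) * (fun s => Re (g s))
    - (fun s => Im (f s)) * (fun s => Im (g s))).
    apply: is_derive_eq; rewrite ReD !ReM /GRing.scale /=; ring.
  by apply/funext => s /=; rewrite ReM.
- rewrite (_ : (fun s => _) = (fun s => Re (f s)) * (fun s => Im (g s))
    + (fun s => Im (f s)) * (fun s => Re (g s))).
    apply: is_derive_eq; rewrite ImD !ImM /GRing.scale /=; ring.
  by apply/funext => s /=; rewrite ImM.
Qed.

Lemma is_cderiveZ t a f df : is_cderive t f df ->
  is_cderive t (fun s => a * f s) (a * df).
Proof.
move=> hf; have := is_cderiveM (is_cderive_cst t a) hf.
by rewrite mul0r add0r mulrC.
Qed.

Lemma is_cderive_expn t k :
  is_cderive t (fun s => (s%:C)%C ^+ k) (k%:R * (t%:C)%C ^+ k.-1).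
Proof.
have hid : is_cderive t (fun s => (s%:C)%C) 1.
  by split => /=; [exact: is_derive_id | exact: is_derive_cst].
elim: k => [|k IH].
  rewrite mul0r (_ : (fun s => _) = fun=> 1); first exact: is_cderive_cst.
  by apply/funext => s; rewrite expr0.
rewrite (_ : (fun s => _) = fun s => (s%:C)%C * (s%:C)%C ^+ k); last first.
  by apply/funext => s; rewrite exprS.
rewrite (_ : _ * _ = 1 * (t%:C)%C ^+ k + k%:R * (t%:C)%C ^+ k.-1 * (t%:C)%C).
  exact: is_cderiveM.
(* At [k = 0] the truncated exponent [k.-1] is harmless, because its coefficient is 0. *)
case: k {IH} => [|k]; first by rewrite !mul0r addr0 !expr0 mulr1.
by rewrite /= -mulrA -exprSr -mulrDl -mulrS.
Qed.

(** This chain rule is preserved by sums and, through the Leibniz rule, by products, so it only has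
    to be checked on constants and variables. *)
Lemma is_cderive_meval n (W : mpoly.mpoly n C) (c : R -> 'I_n -> C)
    (dc : 'I_n -> C) t :
  (forall i, is_cderive t (fun s => c s i) (dc i)) ->
  is_cderive t (fun s => mpoly.meval (c s) W)
    (\sum_i dc i * mpoly.meval (c t) (mpoly.mderiv i W)).
Proof.
move=> hc.
pose P p := is_cderive t (fun s => mpoly.meval (c s) p)
    (\sum_i dc i * mpoly.meval (c t) (mpoly.mderiv i p)).
have PC a : P (mpoly.mpolyC n a).
  rewrite /P big1; last by move=> i _; rewrite mpoly.mderivC mpoly.meval0 mulr0.
  rewrite (_ : (fun s => _) = fun=> a); first exact: is_cderive_cst.
  by apply/funext => s; rewrite mpoly.mevalC.
have PM p q : P p -> P q -> P (p * q).
  move=> hp hq; rewrite /P.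
  rewrite (_ : (fun s => _) = fun s => mpoly.meval (c s) p * mpoly.meval (c s) q);
    last by apply/funext => s; rewrite mpoly.mevalM.
  rewrite (_ : \sum_i _ =
      (\sum_i dc i * mpoly.meval (c t) (mpoly.mderiv i p)) * mpoly.meval (c t) q +
      (\sum_i dc i * mpoly.meval (c t) (mpoly.mderiv i q)) * mpoly.meval (c t) p).
    exact: is_cderiveM.
  rewrite !mulr_suml -big_split; apply: eq_bigr => i _ /=.
  by rewrite mpoly.mderivM mpoly.mevalD !mpoly.mevalM; ring.
have PD p q : P p -> P q -> P (p + q).
  move=> hp hq; rewrite /P.
  rewrite (_ : (fun s => _) = fun s => mpoly.meval (c s) p + mpoly.meval (c s) q);
    last by apply/funext => s; rewrite mpoly.mevalD.
  rewrite (_ : \sum_i _ =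
      (\sum_i dc i * mpoly.meval (c t) (mpoly.mderiv i p)) +
      (\sum_i dc i * mpoly.meval (c t) (mpoly.mderiv i q))).
    exact: is_cderiveD.
  rewrite -big_split; apply: eq_bigr => i _ /=.
  by rewrite mpoly.mderivD mpoly.mevalD mulrDr.
have PX i : P (mpoly.mpolyX C (mpoly.mnm1 i)).
  rewrite /P (_ : (fun s => _) = fun s => c s i); last first.
    by apply/funext => s; rewrite mpoly.mevalXU.
  rewrite (bigD1 i) //= big1 ?addr0 => [|j ji].
    have -> : mpoly.mderiv i (mpoly.mpolyX C (mpoly.mnm1 i)) = 1.
      rewrite mpoly.mderivX mpoly.mnm1E eqxx scale1r -mpoly.mpolyX0.
      congr (mpoly.mpolyX C _); apply/mpoly.mnmP => k.
      by rewrite mpoly.mnmBE subnn mpoly.mnm0E.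
    by rewrite mpoly.meval1 mulr1.
  rewrite mpoly.mderivX mpoly.mnm1E eq_sym (negbTE ji).
  by rewrite scale0r mpoly.meval0 mulr0.
exact: (@mpoly_algebra_ind _ _ P).
Qed.

End ComplexDerivative.

(** * Roots of unity and integrality of angles *)

Section Cis.
Variable R : realType.

Lemma cis2piD (a b : R) : cis2pi (a + b) = cis2pi a * cis2pi b.
Proof.
rewrite /cis2pi mulrDr cosD sinD; apply: eq_ReIm; rewrite ?ReM ?ImM //=.
by rewrite addrC.
Qed.

Lemma cis2pi0 : cis2pi 0 = 1 :> R[i].
Proof. by rewrite /cis2pi mulr0 cos0 sin0. Qed.

Lemma cis2pi_neq0 (a : R) : cis2pi a != 0.
Proof.
apply/eqP => a0; have := cis2piD a (- a).
by rewrite subrr cis2pi0 a0 mul0r => /eqP; rewrite oner_eq0.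
Qed.

Lemma cis2piX (a : R) k : cis2pi (k%:R * a) = cis2pi a ^+ k.
Proof.
elim: k => [|k IH]; first by rewrite mul0r cis2pi0.
by rewrite -addn1 natrD mulrDl mul1r cis2piD IH exprD expr1.
Qed.

Lemma cis2pi1 : cis2pi 1 = 1 :> R[i].
Proof. by rewrite /cis2pi mulr1 mulrC mulr_natr cos2pi sin2pi. Qed.

(** For the direct implication, subtracting the floor leaves f in [0, 1[ with [cis2pi f = 1]. If f
    were positive, then sin(pi f) > 0 and cos(2 pi f) = 1 - 2 sin^2(pi f) < 1. *)
Lemma cis2pi_eq1 (a : R) : cis2pi a = 1 <-> a \is a Num.int.
Proof.
have cis_nat k : cis2pi k%:R = 1 :> R[i].
  by rewrite -[k%:R]mulr1 cis2piX cis2pi1 expr1n.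
have cis_int (m : R) : m \is a Num.int -> cis2pi m = 1.
  move=> /intrP[[k|k] ->]; first exact: cis_nat.
  apply: (mulIf (cis2pi_neq0 k.+1%:R)).
  by rewrite -cis2piD NegzE mulrNz addNr cis2pi0 mul1r cis_nat.
split; last exact: cis_int.
move=> a1; pose f := a - (Num.floor a)%:~R.
have f01 : 0 <= f < 1.
  by rewrite /f; have := floor_itv a; rewrite intrD => /andP[? ?]; apply/andP; split; lra.
have cf : cis2pi f = 1.
  apply: (mulIf (cis2pi_neq0 (Num.floor a)%:~R)).
  by rewrite -cis2piD subrK a1 cis_int ?mulr1 // intr_int.
suff f0 : f = 0 by rewrite -[a](subrK (Num.floor a)%:~R) -/f f0 add0r intr_int.
apply/eqP; move: f01 => /andP[f0 f1]; apply: contraT => fn0.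
have fp : 0 < f by rewrite lt_def fn0.
have sp : 0 < sin (pi * f).
  by apply: sin_gt0_pi; rewrite mulr_gt0 ?pi_gt0 //= gtr_pMr ?pi_gt0.
move: cf => [+ _].
rewrite (_ : 2 * pi * f = (pi * f) *+ 2); last by rewrite -mulrA mulr_natl.
rewrite cos_mulr2n => c1.
have := cos2Dsin2 (pi * f).
have : 0 < sin (pi * f) ^+ 2 by rewrite exprn_gt0.
lra.
Qed.

End Cis.

(** * Linear independence and rank bounds from supports *)

Section Linear.
Variable K : fieldType.

(** Applying [f] to a relation x b + y D = 0 leaves x f(b) = 0, so x = 0; freeness of [D] then gives
    y = 0. *)
Lemma row_free_col_mx1 d m (D : 'M[K]_(d, m)) (b : 'rV[K]_m) (f : 'rV[K]_m -> K) :
  scalar f -> row_free D -> (forall u : 'rV_d, f (u *m D) = 0) -> f b != 0 ->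
  row_free (col_mx b D).
Proof.
move=> lf fD fD0 fb; apply: inj_row_free => v.
rewrite -[v]hsubmxK mul_row_col; set x := lsubmx v; set y := rsubmx v.
rewrite [x]mx11_scalar mul_scalar_mx => e.
have := lf (x 0 0) b (y *m D); rewrite e fD0 addr0.
have -> : f 0 = 0 by have := fD0 0; rewrite mul0mx.
move/esym/eqP; rewrite mulf_eq0 (negbTE fb) orbF => /eqP x0.
move: e; rewrite x0 scale0r add0r => yD.
have -> : y = 0 by apply: (row_free_inj fD); rewrite yD mul0mx.
by rewrite raddf0 row_mx0.
Qed.

(** Keeps a functional zero on the enlarged family, so that it can detect the next vector to be
    added by [row_free_col_mx1]. *)
Lemma mul_col_mx1_eq0 d m (D : 'M[K]_(d, m)) (b : 'rV[K]_m) (f : 'rV[K]_m -> K) :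
  scalar f -> (forall u : 'rV_d, f (u *m D) = 0) -> f b = 0 ->
  forall u : 'rV_(1 + d), f (u *m col_mx b D) = 0.
Proof.
move=> lf fD0 fb v; rewrite -[v]hsubmxK mul_row_col.
by rewrite [lsubmx v]mx11_scalar mul_scalar_mx lf fb fD0 mulr0 addr0.
Qed.

(** [A] is a sum, over the columns in [F], of matrices of rank at most 1. *)
Lemma mxrank_support k m (A : 'M[K]_(k, m)) (F : pred 'I_m) :
  (forall i j, ~~ F j -> A i j = 0) -> (\rank A <= #|F|)%N.
Proof.
move=> A0.
have -> : A = \sum_(j | F j) col j A *m delta_mx 0 j.
  apply/matrixP => i j; rewrite summxE.
  have E (j' : 'I_m) : (col j' A *m delta_mx 0 j) i j = A i j'.
    by rewrite !mxE big_ord1 !mxE !eqxx mulr1.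
  have [Fj|Fj] := boolP (F j).
    rewrite (bigD1 j) //= E big1 ?addr0 // => j' /andP[_ jj'].
    by rewrite !mxE big_ord1 !mxE [j == j']eq_sym (negbTE jj') andbF mulr0.
  rewrite A0 // big1 // => j' Fj'.
  rewrite !mxE big_ord1 !mxE (_ : j == j' = false) ?andbF ?mulr0 //.
  by apply: contraNF Fj => /eqP ->.
rewrite -sum1_card; apply: (big_ind2 (fun (M : 'M[K]_(k, m)) r => (\rank M <= r)%N)).
- by rewrite mxrank0.
- move=> M1 r1 M2 r2 h1 h2.
  by apply: leq_trans (leq_add h1 h2); exact: mxrank_add.
- move=> j _; apply: leq_trans (mxrankM_maxr _ _) _; exact: rank_leq_row.
Qed.

(** The two halves of the columns stand for real and imaginary parts; each half has rank at most
    [#|F|]. *)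
Lemma row_free_support2 k m (A : 'M[K]_(k, m + m)) (F : pred 'I_m) :
  (forall i j, ~~ F j -> A i (lshift m j) = 0 /\ A i (rshift m j) = 0) ->
  row_free A -> (k <= 2 * #|F|)%N.
Proof.
move=> A0 /eqP <-.
have -> : A = lsubmx A *m row_mx 1%:M 0 + rsubmx A *m row_mx 0 1%:M.
  by rewrite !mul_mx_row !mulmx1 !mulmx0 add_row_mx addr0 add0r hsubmxK.
apply: leq_trans (mxrank_add _ _) _; rewrite mul2n -addnn; apply: leq_add.
- apply: leq_trans (mxrankM_maxl _ _) _; apply: mxrank_support => i j Fj.
  by rewrite mxE (A0 i j Fj).1.
- apply: leq_trans (mxrankM_maxl _ _) _; apply: mxrank_support => i j Fj.
  by rewrite mxE (A0 i j Fj).2.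
Qed.

End Linear.

(** * Equivariance of dW, the Euler identity and critical points *)

Section Weighted.
Variables (R : realType) (n : nat) (W : mpoly.mpoly n R[i]).
Local Notation C := R[i].
Implicit Types z u : 'rV[C]_n.

Definition dpeval z u : C := \sum_i u 0 i * peval (partial i W) z.

Lemma is_cderive_peval (c : R -> 'rV[C]_n) u t :
  (forall i, is_cderive t (fun s => c s 0 i) (u 0 i)) ->
  is_cderive t (fun s => peval W (c s)) (dpeval (c t) u).
Proof. exact: is_cderive_meval. Qed.

(** Both sides of the hypothesis are differentiated at s = 0 along the line z + s e_i. This serves
    for the weighted scaling and for the composition of g with the Reeb flow. *)
Lemma partial_diagonal (a : 'I_n -> C) (b : C) :
  (forall z, peval W (\row_i (a i * z 0 i)) = b * peval W z) ->
  forall i z, a i * peval (partial i W) (\row_i (a i * z 0 i))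
    = b * peval (partial i W) z.
Proof.
move=> ab i z.
have line (y v : C) : is_cderive 0 (fun s => y + (s%:C)%C * v) v.
  rewrite -{2}[v]add0r; apply: is_cderiveD; first exact: is_cderive_cst.
  have := is_cderiveM (is_cderive_expn (0 : R) 1) (is_cderive_cst 0 v).
  by rewrite !mul0r addr0 expr0 !mul1r.
pose c s : 'rV[C]_n := \row_j (z 0 j + (s%:C)%C * (j == i)%:R).
have c0 : c 0 = z by apply/rowP => j; rewrite mxE mul0r addr0.
have e1 : is_cderive 0 (fun s => peval W (c s)) (peval (partial i W) z).
  rewrite -[X in is_cderive _ _ X](_ : dpeval (c 0) (\row_j (j == i)%:R) = _).
    apply: is_cderive_peval => j; rewrite mxE.
    rewrite (_ : (fun s => _) = fun s => z 0 j + (s%:C)%C * (j == i)%:R) //.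
    by apply/funext => s; rewrite mxE.
  rewrite c0 /dpeval (bigD1 i) //= big1 ?addr0 => [|j ji].
    by rewrite mxE eqxx mul1r.
  by rewrite mxE (negbTE ji) mul0r.
have e2 := is_cderiveZ b e1.
apply: is_cderive_unique e2.
pose c' s : 'rV[C]_n := \row_j (a j * c s 0 j).
rewrite (_ : (fun s => _) = fun s => peval W (c' s)); last first.
  by apply/funext => s; rewrite ab.
rewrite -[X in is_cderive _ _ X](_ : dpeval (c' 0) (\row_j (a j * (j == i)%:R)) = _).
  apply: is_cderive_peval => j; rewrite mxE.
  rewrite (_ : (fun s => _) = fun s => a j * (z 0 j + (s%:C)%C * (j == i)%:R)).
    exact/is_cderiveZ/line.
  by apply/funext => s; rewrite !mxE.
rewrite /c' c0 /dpeval (bigD1 i) //= big1 ?addr0 => [|j ji].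
  by rewrite mxE eqxx mulr1.
by rewrite mxE (negbTE ji) mulr0 mul0r.
Qed.

Variables (w : 'I_n -> nat) (h : nat).
Hypothesis hW : weighted_homogeneous W w h.

(** Differentiate W(s^w z) = s^h W(z) at s = 1. *)
Lemma euler z : dpeval z (\row_i ((w i)%:R * z 0 i)) = h%:R * peval W z.
Proof.
have [_ _ _ hom] := hW.
pose c (s : R) : 'rV[C]_n := \row_i ((s%:C)%C ^+ w i * z 0 i).
have c1 : c 1 = z by apply/rowP => j; rewrite mxE expr1n mul1r.
have e (k : nat) y : is_cderive (1 : R) (fun s => (s%:C)%C ^+ k * y) (k%:R * y).
  have := is_cderiveM (is_cderive_expn (1 : R) k) (is_cderive_cst 1 y).
  by rewrite mul0r addr0 expr1n mulr1.
rewrite -[z in dpeval z]c1.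
apply: (@is_cderive_unique _ 1 (fun s => peval W (c s))).
  apply: is_cderive_peval => i; rewrite mxE.
  rewrite (_ : (fun s => _) = fun s : R => (s%:C)%C ^+ w i * z 0 i) //.
  by apply/funext => s; rewrite mxE.
rewrite (_ : (fun s => _) = fun s : R => (s%:C)%C ^+ h * peval W z) //.
by apply/funext => s; rewrite hom.
Qed.

(** The critical set is stable under the weighted scaling, which brings any critical point into the
    ball where 0 is the only one. *)
Lemma critical_eq0 z : isolated_singularity0 W -> critical W z -> z = 0.
Proof.
move=> [_ [e e0 he]] cz; have [w0 _ _ hom] := hW.
have sq0 : 0 <= sqnorm z by apply: sumr_ge0 => i _; rewrite addr_ge0 ?sqr_ge0.
(* With this factor lam |z|^2 < e. Since lam <= 1 and all weights are positive, the scaled point has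
   squared norm at most lam |z|^2. *)
pose lam := e / (e + sqnorm z).
have es0 : 0 < e + sqnorm z by rewrite ltr_wpDr.
have lam0 : 0 < lam by rewrite divr_gt0.
have lam1 : lam <= 1 by rewrite ler_pdivrMr // mul1r lerDl.
have lamC : (lam%:C)%C != 0 :> C by apply/eqP => -[/eqP]; rewrite gt_eqF.
pose y : 'rV[C]_n := \row_i ((lam%:C)%C ^+ w i * z 0 i).
have y0 : y = 0.
  apply: he.
    apply: (@le_lt_trans _ _ (lam * sqnorm z)).
      rewrite mulr_sumr; apply: ler_sum => i _.
      have -> : y 0 i = ((lam ^+ w i)%:C)%C * z 0 i by rewrite mxE rmorphXn.
      case: (z 0 i) => p q /=; rewrite !mul0r subr0 addr0 !(exprMn _ (lam ^+ w i)) -mulrDr.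
      apply: ler_wpM2r; first by rewrite addr_ge0 ?sqr_ge0.
      rewrite -exprM; apply: ler_iXnr; rewrite ?(ltW lam0) //.
      by rewrite muln_gt0 w0.
    rewrite /lam mulrAC ltr_pdivrMr // mulrDr ltrDr.
    by rewrite mulr_gt0.
  move=> i; apply: (mulfI (expf_neq0 (w i) lamC)).
  by rewrite (partial_diagonal (hom _)) cz !mulr0.
apply/rowP => i; move/rowP: y0 => /(_ i); rewrite !mxE => /eqP.
by rewrite mulf_eq0 expf_eq0 (negbTE lamC) andbF /= => /eqP.
Qed.

End Weighted.

(** * Restricting functions and open sets to real lines *)

Section Lines.
Variable R : realType.

(** The difference quotient of the restriction at 0 is that of [g] at [x] in the direction [v]. *)
Lemma is_derive_line (V : normedModType R) (g : V -> R) (x v : V) dg :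
  is_derive x v g dg -> is_derive (0 : R) 1 (fun s => g (s *: v + x)) dg.
Proof.
have E : (fun k : R => k^-1 *: (((fun s => g (s *: v + x)) \o shift 0) (k *: (1 : R)) -
       (fun s => g (s *: v + x)) 0)) =
    (fun k => k^-1 *: ((g \o shift x) (k *: v) - g x)).
  apply/funext => k /=; rewrite scale0r add0r addr0.
  by rewrite (_ : k *: (1 : R) = k) // /GRing.scale /= mulr1.
move=> [dg1 dg2]; split; first by rewrite /derivable E.
by rewrite /derive E.
Qed.

Lemma is_derive_coord_line d N (phi : 'rV[R]_d -> 'rV[R]_N) x v j :
  differentiable phi x ->
  is_derive (0 : R) 1 (fun s => phi (s *: v + x) 0 j) ('d phi x v 0 j).
Proof.
move=> dphi; have dv : derivable phi x v by exact: diff_derivable.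
apply: (@is_derive_line _ (fun y => phi y 0 j)).
apply: DeriveDef; first exact: (derivable_mxP _ _ _).1 dv 0 j.
by rewrite -deriveE // derive_mx // mxE.
Qed.

Lemma near_line (V : normedModType R) (A : set V) (x v : V) :
  open A -> A x -> \forall s \near (0 : R), A (s *: v + x).
Proof.
move=> oA Ax.
have c : (fun s : R => s *: v + x) @ (0 : R) --> x.
  rewrite -[X in _ --> X]add0r -[X in _ --> X + _](scale0r v).
  apply: cvgD; last exact: cvg_cst.
  by apply: cvgZr_tmp; exact: cvg_id.
by apply: c; apply: open_nbhs_nbhs.
Qed.

Lemma is_derive_near_cst (f : R -> R) (a df : R) :
  (\forall s \near (0 : R), f s = a) ->
  is_derive (0 : R) 1 f df -> df = 0.
Proof.
move=> fa hf.
have h0 : is_derive (0 : R) 1 f 0.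
  apply: (near_eq_is_derive _ (is_derive_cst a _ _)).
  by apply: filterS fa => s ->.
by rewrite -(@derive_val _ _ _ _ _ _ _ hf) (@derive_val _ _ _ _ _ _ _ h0).
Qed.

End Lines.

(** * Tangent vectors of Sigma and the dimension bounds *)

Section TangentFrame.
Variables (R : realType) (n : nat) (W : mpoly.mpoly n R[i]).
Variables (w : 'I_n -> nat) (h : nat) (delta : R) (theta : 'I_n -> R) (l : R).
Local Notation C := R[i].
Local Notation Sig := (Sigma W w h delta theta l).

Definition complexify (u : 'rV[R]_(n + n)) : 'rV[C]_n :=
  \row_i (u 0 (lshift n i) +i* u 0 (rshift n i))%C.

Lemma realifyK : cancel (@realify R n) complexify.
Proof.
move=> z; apply/rowP => i; rewrite mxE /realify row_mxEl row_mxEr !mxE.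
by case: (z 0 i).
Qed.

Definition fixed_coord : pred 'I_n :=
  fun i => theta i + l * thetaJ R w h i \is a Num.int.

(** Half the differential of [sqnorm] at [z]. *)
Definition sphere_form (z : 'rV[C]_n) (u : 'rV[R]_(n + n)) : R :=
  \sum_i (complex.Re (z 0 i) * u 0 (lshift n i)
          + complex.Im (z 0 i) * u 0 (rshift n i)).

(** The equations of [Sigma], linearized at [z]. An upper bound on the dimension only needs that the
    image of the differential of a parametrization satisfies them. *)
Definition tangent (z : 'rV[C]_n) (u : 'rV[R]_(n + n)) : Prop :=
  [/\ forall j, ~~ fixed_coord j -> u 0 (lshift n j) = 0 /\ u 0 (rshift n j) = 0,
      sphere_form z u = 0 & dpeval W z (complexify u) = 0].

(** As [V] is open, s |-> phi(s v + x) stays in [Sigma] for s near 0. The coordinates outside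
    [fixed_coord], the squared norm and W are constant there, so their derivatives vanish. *)
Lemma tangent_parametrization d U V (phi : 'rV[R]_d -> 'rV[R]_(n + n)) psi x v :
  C1_parametrization (@realify R n @` Sig) U V phi psi -> V x ->
  tangent (complexify (phi x)) ('d phi x v).
Proof.
move=> [oV imV diffV _ _] Vx; have [dphi _ _] := diffV x Vx.
have hS y : V y -> Sig (complexify (phi y)).
  move=> Vy; have : (phi @` V) (phi y) by exists y.
  by rewrite imV => -[[z zS <-] _]; rewrite realifyK.
have near_S : \forall s \near (0 : R), Sig (complexify (phi (s *: v + x))).
  by apply: filterS (near_line v oV Vx) => s /hS.
have dj j := @is_derive_coord_line _ _ _ _ x v j dphi.
split.
- move=> j Fj.
  have fx s : Sig (complexify (phi (s *: v + x))) ->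
      phi (s *: v + x) 0 (lshift n j) = 0 /\ phi (s *: v + x) 0 (rshift n j) = 0.
    move=> [/(_ j) + _]; rewrite mxE => hf.
    have [/eqP[-> ->] //|/hf] := boolP ((phi (s *: v + x) 0 (lshift n j) +i*
      phi (s *: v + x) 0 (rshift n j))%C == 0).
    by rewrite /fixed_coord in Fj; rewrite (negbTE Fj).
  by split; apply: (@is_derive_near_cst _ _ 0) (dj _); apply: filterS near_S => s /fx[].
- pose q i (s : R) := phi (s *: v + x) 0 i.
  have dq : is_derive (0 : R) 1 (\sum_i (q (lshift n i) ^+ 2 + q (rshift n i) ^+ 2))
      (2 * sphere_form (complexify (phi x)) ('d phi x v)).
    rewrite /sphere_form mulr_sumr; apply: is_derive_sum => i.
    rewrite !mxE /=.
    have hl : is_derive (0 : R) 1 (q (lshift n i)) ('d phi x v 0 (lshift n i)) := dj _.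
    have hr : is_derive (0 : R) 1 (q (rshift n i)) ('d phi x v 0 (rshift n i)) := dj _.
    apply: is_derive_eq; rewrite /q !scale0r !add0r /GRing.scale /= expr1; ring.
  have := is_derive_near_cst (a := delta ^+ 2) _ dq.
  move=> e; suff : 2 * sphere_form (complexify (phi x)) ('d phi x v) = 0 by lra.
  apply: e; apply: filterS near_S => s [_ [_ <-]].
  by rewrite fct_sumE; apply: eq_bigr => i _; rewrite !mxE.
- have e : is_cderive 0 (fun s => peval W (complexify (phi (s *: v + x))))
      (dpeval W (complexify (phi x)) (complexify ('d phi x v))).
    have := @is_cderive_peval R n W (fun s => complexify (phi (s *: v + x)))
      (complexify ('d phi x v)) 0.
    rewrite scale0r add0r; apply => i.
    by rewrite mxE; split => /=;
      [rewrite (_ : (fun s => _) = fun s => phi (s *: v + x) 0 (lshift n i))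
      |rewrite (_ : (fun s => _) = fun s => phi (s *: v + x) 0 (rshift n i))] => //;
      apply/funext => s; rewrite mxE.
  apply: is_cderive_unique e _; apply: near_eq_is_cderive (is_cderive_cst 0 0).
  by apply: filterS near_S => s [_ [-> _]].
Qed.

Definition tangent_frame d (z : 'rV[C]_n) (D : 'M[R]_(d, n + n)) :=
  row_free D /\ forall u, tangent z (u *m D).

Lemma tangent_frame_submanifold d z : Sig z ->
  submanifold d (@realify R n @` Sig) -> exists D : 'M[R]_(d, _), tangent_frame z D.
Proof.
move=> zS hd; have [|U [oU Uz [V [phi [psi hp]]]]] := hd (realify z).
  by exists z.
have [_ imV diffV _ _] := hp.
have [x Vx xz] : (phi @` V) (realify z) by rewrite imV; split => //; exists z.
have [_ _ inj] := diffV x Vx.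
exists (lin1_mx ('d phi x)); split.
  apply: inj_row_free => v; rewrite mul_rV_lin1 => v0.
  by apply: inj; rewrite v0 linear0.
move=> u; rewrite mul_rV_lin1.
by have := tangent_parametrization u hp Vx; rewrite xz realifyK.
Qed.

Lemma tangent_frame_dimR z : Sig z ->
  exists D : 'M[R]_(dimR (@realify R n @` Sig), _), tangent_frame z D.
Proof.
move=> zS; rewrite /dimR; case: xgetP => [d -> hd|_].
  exact: tangent_frame_submanifold hd.
(* When [Sigma] is a submanifold of no dimension, [dimR] takes its default value 0 and the empty
   frame suffices. *)
exists 0; split; first by apply: inj_row_free => v _; apply/rowP; case.
move=> u; rewrite mulmx0; split.
- by move=> j _; rewrite !mxE.
- by apply: big1 => i _; rewrite !mxE !mulr0 addr0.
- by apply: big1 => i _; rewrite !mxE mul0r.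
Qed.

Lemma scalar_sphere_form z : scalar (sphere_form z).
Proof.
move=> a u v; rewrite /sphere_form mulr_sumr -big_split; apply: eq_bigr => i _ /=.
by rewrite !mxE; ring.
Qed.

Lemma dpeval_complexifyP z a u v :
  dpeval W z (complexify (a *: u + v)) =
  (a%:C)%C * dpeval W z (complexify u) + dpeval W z (complexify v).
Proof.
rewrite /dpeval mulr_sumr -big_split; apply: eq_bigr => i _ /=.
rewrite mulrA -mulrDl; congr (_ * _); rewrite !mxE.
by apply: eq_ReIm => /=; rewrite !mul0r ?subr0 ?addr0.
Qed.

Lemma scalar_Re_dpeval z : scalar (fun u => complex.Re (dpeval W z (complexify u))).
Proof.
move=> a u v; rewrite dpeval_complexifyP ReD.
by case: (dpeval W z (complexify u)) => p q /=; rewrite mul0r subr0.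
Qed.

Lemma scalar_Im_dpeval z : scalar (fun u => complex.Im (dpeval W z (complexify u))).
Proof.
move=> a u v; rewrite dpeval_complexifyP ImD.
by case: (dpeval W z (complexify u)) => p q /=; rewrite mul0r addr0.
Qed.

Hypotheses (hW : weighted_homogeneous W w h) (hdelta : 0 < delta).

(** The velocity at s = 1 of the curve with coordinates s^(w i) z_i. *)
Definition euler_field (z : 'rV[C]_n) : 'rV[C]_n := \row_i ((w i)%:R * z 0 i).

(** The value is the sum of the w_i |z_i|^2, which is at least |z|^2 = delta^2 because all weights
    are at least 1. *)
Lemma sphere_form_euler z : Sig z -> sphere_form z (realify (euler_field z)) != 0.
Proof.
move=> [_ [_ zd]]; have [w0 _ _ _] := hW.
rewrite gt_eqF //; apply: (@lt_le_trans _ _ (sqnorm z)).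
  by rewrite zd exprn_gt0.
apply: ler_sum => i _; rewrite row_mxEl row_mxEr !mxE.
have wi : 1 <= (w i)%:R :> R by rewrite ler1n.
have -> : (w i)%:R = (((w i)%:R : R)%:C)%C :> C by rewrite rmorph_nat.
case: (z 0 i) => p q /=; rewrite !mul0r subr0 addr0.
by have := sqr_ge0 p; have := sqr_ge0 q; rewrite !expr2; nra.
Qed.

Lemma realify_support (z : 'rV[C]_n) j : z 0 j = 0 ->
  realify z 0 (lshift n j) = 0 /\ realify z 0 (rshift n j) = 0.
Proof. by move=> zj; rewrite row_mxEl row_mxEr !mxE zj. Qed.

Lemma euler_support z j : Sig z -> ~~ fixed_coord j -> euler_field z 0 j = 0.
Proof.
move=> [/(_ j) zf _] Fj; rewrite mxE.
have [->|/zf] := eqVneq (z 0 j) 0; first by rewrite mulr0.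
by move: Fj; rewrite /fixed_coord => /negbTE ->.
Qed.

Definition supported k (A : 'M[R]_(k, n + n)) := forall i j, ~~ fixed_coord j ->
  A i (lshift n j) = 0 /\ A i (rshift n j) = 0.

Lemma supported_tangent_frame d z (D : 'M[R]_(d, _)) : tangent_frame z D -> supported D.
Proof.
move=> [_ tD] i j Fj; have [/(_ j Fj) + _ _] := tD (delta_mx 0 i).
by rewrite -rowE !mxE.
Qed.

Lemma supported_col_mx k (z : 'rV[C]_n) (A : 'M[R]_(k, _)) :
  (forall j, ~~ fixed_coord j -> z 0 j = 0) -> supported A ->
  supported (col_mx (realify z) A).
Proof.
move=> hz hA i j Fj; case: (split_ordP i) => k' ->.
  by rewrite !col_mxEu ord1; apply/realify_support/hz.
by rewrite !col_mxEd; exact: hA.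
Qed.

(** The sphere form kills the frame but not the Euler field, so the two together are independent.
    All these vectors live in the fixed coordinates, a real space of dimension 2N. *)
Lemma tangent_frame_dim1 d z (D : 'M[R]_(d, _)) : Sig z -> tangent_frame z D ->
  (d + 1 <= 2 * #|fixed_coord|)%N.
Proof.
move=> zS hD; have [fD tD] := hD; rewrite addnC.
apply: (@row_free_support2 _ _ _ (col_mx (realify (euler_field z)) D)).
  apply: supported_col_mx (supported_tangent_frame hD) => j.
  exact: euler_support.
apply: (row_free_col_mx1 (scalar_sphere_form z)) => // [u|].
  by have [] := tD u.
exact: sphere_form_euler.
Qed.

(* The Euler field and a complex line transverse to ker dW in the fixed locus are
   independent of the tangent space of Sigma. *)
Lemma tangent_frame_dim3 d z (D : 'M[R]_(d, _)) i : Sig z -> tangent_frame z D ->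
  fixed_coord i -> peval (partial i W) z != 0 -> (d + 3 <= 2 * #|fixed_coord|)%N.
Proof.
move=> zS hD Fi di; have [fD tD] := hD; rewrite addnC.
(* Normalized so that dW takes the value [a] on [v a]. With a = 1 and a = i, the two vectors are
   detected by the real and the imaginary part of dW in turn. *)
pose v (a : C) : 'rV[C]_n := \row_j (if j == i then a / peval (partial i W) z else 0).
have vS a j : ~~ fixed_coord j -> v a 0 j = 0.
  by move=> Fj; rewrite mxE; case: eqP Fj => // ->; rewrite Fi.
have dv a : dpeval W z (complexify (realify (v a))) = a.
  rewrite realifyK /dpeval (bigD1 i) //= big1 ?addr0 => [|j ji].
    by rewrite mxE eqxx divfK.
  by rewrite mxE (negbTE ji) mul0r.
have dE : dpeval W z (complexify (realify (euler_field z))) = 0.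
  (* Euler's identity together with W(z) = 0 on the link. *)
  by rewrite realifyK (euler hW); have [_ [-> _]] := zS; rewrite mulr0.
pose D1 := col_mx (realify (euler_field z)) D.
pose D2 := col_mx (realify (v 1)) D1.
pose D3 := col_mx (realify (v 'i%C)) D2.
apply: (@row_free_support2 _ _ _ D3).
  apply: supported_col_mx; first exact: vS.
  apply: supported_col_mx; first exact: vS.
  apply: supported_col_mx (supported_tangent_frame hD) => j.
  exact: euler_support.
have f1 : row_free D1.
  apply: (row_free_col_mx1 (scalar_sphere_form z)) => // [u|].
    by have [] := tD u.
  exact: sphere_form_euler.
have re1 : forall u, complex.Re (dpeval W z (complexify (u *m D1))) = 0.
  apply: (mul_col_mx1_eq0 (scalar_Re_dpeval z)); last by rewrite dE.
  by move=> u; have [_ _ ->] := tD u.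
have im1 : forall u, complex.Im (dpeval W z (complexify (u *m D1))) = 0.
  apply: (mul_col_mx1_eq0 (scalar_Im_dpeval z)); last by rewrite dE.
  by move=> u; have [_ _ ->] := tD u.
have f2 : row_free D2.
  by apply: (row_free_col_mx1 (scalar_Re_dpeval z)) => //; rewrite dv /= oner_eq0.
apply: (row_free_col_mx1 (scalar_Im_dpeval z)) => //; last by rewrite dv /= oner_eq0.
by apply: (mul_col_mx1_eq0 (scalar_Im_dpeval z)); rewrite ?dv.
Qed.

End TangentFrame.

(** * Integrality outside I and the final estimate *)

Lemma Q_int (R : realType) (s : R) : s \is a Num.int -> Q s = 2 * s.
Proof. by rewrite /Q => ->. Qed.

Lemma Q_le (R : realType) (s : R) : Q s <= 2 * s + (s \isn't a Num.int)%:R.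
Proof.
rewrite /Q; case: ifP => _ /=; first by rewrite addr0.
by have := floor_le s; lra.
Qed.

(** With lam = exp(2 pi i l / h), the factors [a j] = g_j lam^(w j) are those of g composed with the
    Reeb flow at time l. They multiply W by exp(2 pi i l) and fix every point of the fixed locus. At
    such a point where the i-th partial derivative is nonzero, [partial_diagonal] forces [a i] =
    exp(2 pi i l). *)
Lemma Icompl_int (R : realType) (n : nat) (W : mpoly.mpoly n R[i])
    (w : 'I_n -> nat) (h : nat) (g : 'rV[R[i]]_n) (theta : 'I_n -> R) (l : R) i :
  weighted_homogeneous W w h -> diagonal_symmetries W g -> angles_of g theta ->
  Iset_compl W w h theta l i -> fixed_coord w h theta l i = (l \is a Num.int).
Proof.
move=> [_ h0 _ hom] [_ gW] gth /asboolPn /existsNP[z /not_implyP[zf /eqP dz]].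
pose lam := cis2pi (l / h%:R).
pose a j := cis2pi (theta j + l * thetaJ R w h j).
have aE j : a j = g 0 j * lam ^+ w j.
  rewrite /a cis2piD (gth j).2; congr (_ * _).
  by rewrite -cis2piX /thetaJ; congr cis2pi; ring.
have lamh : lam ^+ h = cis2pi l.
  by rewrite -cis2piX mulrC divfK // pnatr_eq0 -lt0n.
have aW (y : 'rV[R[i]]_n) : peval W (\row_j (a j * y 0 j)) = cis2pi l * peval W y.
  rewrite -lamh -hom -[RHS]gW; congr peval.
  by apply/rowP => j; rewrite !mxE aE mulrA.
have az : (\row_j (a j * z 0 j) : 'rV[R[i]]_n) = z.
  apply/rowP => j; rewrite mxE.
  have [->|/zf/cis2pi_eq1 aj] := eqVneq (z 0 j) 0; first by rewrite mulr0.
  by rewrite /a aj mul1r.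
have := partial_diagonal aW i z; rewrite az => /(mulIf dz) al.
by apply/idP/idP => /cis2pi_eq1 e; apply/cis2pi_eq1; move: al; rewrite /a e.
Qed.

(** Reduces inequalities between cardinals to comparisons index by index. *)
Lemma card_pred_sum (n : nat) (P : pred 'I_n) : #|P| = (\sum_i P i)%N.
Proof.
rewrite -sum1_card big_mkcond; apply: eq_bigr => i _.
by rewrite unfold_in; case: (P i).
Qed.

Theorem proposition8p19 (R : realType) (n : nat) (W : mpoly.mpoly n R[i])
    (w : 'I_n -> nat) (h : nat)
    (hW : weighted_homogeneous W w h) (hnd : nondegenerate_poly W)
    (delta : R) (hdelta : 0 < delta)
    (g : 'rV[R[i]]_n) (hg : diagonal_symmetries W g)
    (theta : 'I_n -> R) (htheta : angles_of g theta)
    (l : R) (hl : 0 < l)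
    (hSigma : Sigma W w h delta theta l !=set0) :
  star W w h delta theta l
    >= - (2 * l * (\sum_(k < n) (w k)%:R - h%:R)) / h%:R.
Proof.
have [z zS] := hSigma.
have [i0 di0] : exists i, peval (partial i W) z != 0.
  (* Otherwise [z] would be critical, hence 0, against |z| = delta > 0. *)
  apply: contrapT => /forallNP dz.
  have z0 : z = 0.
    apply: (critical_eq0 hW hnd.1) => i; apply: contrapT => /eqP; exact: dz.
  have [_ [_]] := zS; rewrite z0 /sqnorm big1 => [|i _].
    by move=> /eqP; rewrite eq_sym expf_eq0 gt_eqF.
  by rewrite mxE /= expr0n addr0.
pose F := fixed_coord w h theta l.
pose I := Iset W w h theta l.
have i0I : ~~ I i0 by apply/asboolP => /(_ z zS.1) /eqP; rewrite (negbTE di0).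
have IF i : ~~ I i -> F i = (l \is a Num.int) by exact: Icompl_int hW hg htheta.
pose dim := dimR (@realify R n @` Sigma W w h delta theta l).
have [D hD] := tangent_frame_dimR zS.
pose m := #|[pred i | ~~ I i]|.
pose N := #|F|.
(* Counts the indices of I whose term in [T] can be negative, each being at least -1. *)
pose K := #|[pred i | I i && ~~ F i]|.
have m0 : (0 < m)%N by apply/card_gt0P; exists i0.
pose T := \sum_(i | I i)
  (2 * (l * thetaJ R w h i + theta i) - Q (l * thetaJ R w h i + theta i)).
have TK : - K%:R <= T.
  rewrite /K card_pred_sum natr_sum -sumrN /T [leRHS]big_mkcond.
  apply: ler_sum => i _ /=; case: (I i) => /=; last by rewrite oppr0.
  have := Q_le (l * thetaJ R w h i + theta i).
  by rewrite /F /fixed_coord [theta i + _]addrC; lra.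
have main : 0 <= n%:R - 1 - (dim%:R + 1) / 2 + T + (m%:R - 1) * (2 * l - Q l).
  have [lint|lint] := boolP (l \is a Num.int).
    (* Here [i0] lies in [F], so (dim + 1)/2 <= N - 1, and n - N - K >= 0 remains because [K] counts
       indices outside [F]. *)
    rewrite (Q_int lint) subrr mulr0 addr0.
    have d3 : (dim + 3 <= 2 * N)%N.
      by apply: (tangent_frame_dim3 hW hdelta zS hD _ di0); rewrite -/F IF.
    have KN : (K + N <= n)%N.
      rewrite /K /N !card_pred_sum -big_split -[X in (_ <= X)%N]card_ord -sum1_card.
      by apply: leq_sum => i _ /=; case: (I i); case: (F i).
    have {}d3 : dim%:R + 3 <= 2 * N%:R :> R by rewrite -natrM -natrD ler_nat.
    have {}KN : K%:R + N%:R <= n%:R :> R by rewrite -natrD ler_nat.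
    by lra.
  (* Now [F] lies in I, so [K], [N] and [m] count disjoint sets. The last term is at least -(m - 1),
     and what remains is n - N - K - m >= 0. *)
  have d1 : (dim + 1 <= 2 * N)%N by exact: (tangent_frame_dim1 hW hdelta zS hD).
  have KN : (K + N + m <= n)%N.
    rewrite /K /N /m !card_pred_sum -!big_split -[X in (_ <= X)%N]card_ord -sum1_card.
    apply: leq_sum => i _ /=; have := @IF i; case: (I i) => /=; case: (F i) => //.
    by move=> /(_ isT) e; rewrite -e in lint.
  have {}d1 : dim%:R + 1 <= 2 * N%:R :> R by rewrite natr1 -natrM ler_nat -addn1.
  have {}KN : K%:R + N%:R + m%:R <= n%:R :> R by rewrite -!natrD ler_nat.
  have m1 : 1 <= m%:R :> R by rewrite ler1n.
  have Ql : - 1 <= 2 * l - Q l by have := Q_le l; rewrite lint /=; lra.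
  have : 0 <= (m%:R - 1) * (2 * l - Q l + 1) by apply: mulr_ge0; lra.
  by lra.
have [_ h0 _ _] := hW.
have -> : - (2 * l * (\sum_(k < n) (w k)%:R - h%:R)) / h%:R
    = 2 * l - 2 * (l * \sum_k thetaJ R w h k).
  rewrite /thetaJ -mulr_suml.
  by field; rewrite pnatr_eq0 -lt0n.
(* The part outside I cancels against the same sum in [arg_change]; the part in I enters [T]. *)
have Jsplit : l * (\sum_k thetaJ R w h k) =
    \sum_(i | I i) l * thetaJ R w h i + \sum_(i | ~~ I i) l * thetaJ R w h i.
  by rewrite mulr_sumr (bigID I).
rewrite Jsplit /star /mu_RS /arg_change /RS_in_frame -/dim.
rewrite (_ : #|_| = m) // sumrB sumr_const (_ : #|_| = m) // -mulr_natl.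
have TE : T = 2 * (\sum_(i | I i) l * thetaJ R w h i) + 2 * (\sum_(i | I i) theta i)
    - \sum_(i | I i) Q (l * thetaJ R w h i + theta i).
  by rewrite /T sumrB -mulrDr -big_split mulr_sumr.
move: main; rewrite TE -/I /Iset_compl -/I.
by lra.
Qed.
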